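(* Fix an integer base $q\ge2$. Let $x>0$ and let $K$ be an integer with $0\le K\le\frac25\log_qx$. Let $Q$ be an integer with $q^K\le Q\le xq^{-K}$, and let $A$ be an integer with $\gcd(A,Q)=1$. Then $$\left|\sum_{p\le x}e\left(\frac AQp\right)\right|\le102\,(\log x)^2\,x\,q^{-K/2},$$ where the sum is over primes $p\le x$.
   Context: $e(t)=e^{2\pi it}$; $\log$ is the natural logarithm and $\log_q$ the base-$q$ logarithm. *)

(* Defs.v *)
From mathcomp Require Import all_boot all_order all_algebra.
From mathcomp Require Import reals exp trigo.
From mathcomp Require Import complex.

Set Implicit Arguments.
Unset Strict Implicit.
Unset Printing Implicit Defensive.

Import Order.TTheory GRing.Theory Num.Theory.
Local Open Scope ring_scope.
Local Open Scope complex_scope.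

(* e(t) = exp(2 pi i t), written out with Euler's formula as the library has
   no complex exponential. *)
Definition e_ (R : realType) (t : R) : R[i] :=
  cos (2 * pi * t) +i* sin (2 * pi * t).

Definition log_base (R : realType) (q : nat) (x : R) : R := ln x / ln q%:R.

(* For x >= 0, Num.truncn x is the integer part of x, so that the index p
   runs over all natural numbers with p <= x. *)
Definition prime_exp_sum (R : realType) (x alpha : R) : R[i] :=
  \sum_(0 <= p < (Num.truncn x).+1 | prime p) e_ (alpha * p%:R).

(* Main.v *)
Require Import Defs.
From mathcomp Require Import all_boot all_order all_algebra.
From mathcomp Require Import reals exp trigo.
From mathcomp Require Import complex.
From mathcomp Require Import ring lra zify.

Set Implicit Arguments.
Unset Strict Implicit.
Unset Printing Implicit Defensive.

Import Order.TTheory GRing.Theory Num.Theory.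
Local Open Scope ring_scope.
Local Open Scope complex_scope.

(** The sum is estimated by Vaughan's method.  Put P = q ^ K, s = sqrt P,
L = ln x and X = x / s; the hypotheses give s ^ 5 <= x and P <= Q <= x / P, and
the claim is a bound 102 L ^ 2 X.

A geometric sum whose ratio is e (j / Q), with j not divisible by Q, is bounded
by Q / j + Q / (Q - j), with j reduced modulo Q, independently of its length.
As A is invertible modulo Q, the frequencies A r / Q of Q consecutive r run over
all residues, so on average over r these sums cost only a factor of order ln Q
(sum_spike_linear).

The von Mangoldt function restricted to m >= P is the convolution of the
Moebius function with the coefficients b l, the sum of mangoldt m over the
divisors m >= P of l, and 0 <= b l <= ln l (vaughan_identity).  When the Moebius
variable d is less than P, b is replaced by ln minus the complementary sum
over m < P, and every inner sum is geometric up to a smooth weight; the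
frequencies involved are below P and below P ^ 2, and P ^ 2 <= X by the
hypothesis on K (typeI_ln_le, typeI_mangoldt_le).  When d >= P, also l >= P.
Then d is split into dyadic blocks, and Cauchy-Schwarz followed by summation
over d leaves geometric sums with frequencies l - l' (typeII_block_le).  As both
variables and Q lie between P and x / P, each block saves a factor s; only
the bounds |moebius d| <= 1 and b l <= L are used for the coefficients, so
that the total stays below 31 L ^ 3 X (mangoldt_phase_sum_le).

Proper prime powers contribute at most sqrt x * L, and partial summation divides
by L / 2, which gives 65 L ^ 2 X (prime_phase_sum_le).  This needs L >= 1; for
smaller L the sum is bounded by its number of terms. *)

(** * The additive character *)
Section Phases.
Variable R : realType.
Local Notation C := R[i].
Local Notation normc := ComplexField.Normc.normc.
Implicit Types (s t : R) (z w : C).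

Lemma normcX z n : normc (z ^+ n) = normc z ^+ n.
Proof.
elim: n => [|n IHn]; first exact: ComplexField.Normc.normc1.
by rewrite !exprS ComplexField.Normc.normcM IHn.
Qed.

Lemma le_normcB z w : normc (z - w) <= normc z + normc w.
Proof. exact: (@ler_normB R (Rcomplex R)). Qed.

Lemma le_normc_sum (I : Type) (r : seq I) (P : pred I) (F : I -> C) :
  normc (\sum_(i <- r | P i) F i) <= \sum_(i <- r | P i) normc (F i).
Proof. exact: (@ler_norm_sum R (Rcomplex R)). Qed.

Lemma e_D s t : e_ (s + t) = e_ s * e_ t.
Proof.
rewrite /e_ mulrDr cosD sinD.
by apply/eqP; rewrite eq_complex /= eqxx [X in _ == X]addrC eqxx.
Qed.

Lemma e_0 : e_ (0 : R) = 1.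
Proof. by rewrite /e_ mulr0 cos0 sin0. Qed.

Lemma normc_e_ t : normc (e_ t) = 1.
Proof. by rewrite /= cos2Dsin2 sqrtr1. Qed.

Lemma e_1 : e_ (1 : R) = 1.
Proof. by rewrite /e_ mulr1 mulrC mulr_natr cos2pi sin2pi. Qed.

Lemma e_Mn t n : e_ (t * n%:R) = e_ t ^+ n.
Proof.
elim: n => [|n IHn]; first by rewrite mulr0 e_0 expr0.
by rewrite exprS -addn1 natrD mulrDr mulr1 addrC e_D IHn.
Qed.

Lemma e_nat n : e_ (n%:R : R) = 1.
Proof. by rewrite -[n%:R]mul1r e_Mn e_1 expr1n. Qed.

Lemma e_N t : e_ t * e_ (- t) = 1.
Proof. by rewrite -e_D subrr e_0. Qed.

Lemma e_int (m : int) : e_ (m%:~R : R) = 1.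
Proof.
case: m => n; first exact: e_nat.
by rewrite NegzE mulrNz; have := e_N n.+1%:R; rewrite e_nat mul1r.
Qed.

Lemma conj_e_ t : conjc (e_ t) = e_ (- t).
Proof. by rewrite /e_ mulrN cosN sinN. Qed.

Lemma e_modn Q m : (0 < Q)%N -> e_ ((m %% Q)%:R / Q%:R) = e_ (m%:R / Q%:R : R).
Proof.
move=> Q0; rewrite {2}(divn_eq m Q) natrD mulrDl natrM mulfK ?pnatr_eq0 -?lt0n//.
by rewrite e_D e_nat mul1r.
Qed.

(** A point of the circle with argument between a quarter and a half turn has
nonpositive real part, so it is at distance at least 1 from 1. *)
Lemma normc_one_sub_e_ge1 t : 1 / 4 <= t <= 1 / 2 -> 1 <= normc (1 - e_ t).
Proof.
move=> /andP[t1 t2].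
have c0 : cos (2 * pi * t) <= 0.
  rewrite -oppr_ge0 -cosN -cosDpi cos_ge0_pihalf //.
  have := pi_gt0 R; nra.
rewrite -[leLHS]sqrtr1 /= ler_sqrt ?addr_ge0 ?sqr_ge0//=.
have := cos2Dsin2 (2 * pi * t); rewrite sub0r sqrrN => h; nra.
Qed.

Lemma normc_one_sub_expr z n : normc z = 1 ->
  normc (1 - z ^+ n) <= n%:R * normc (1 - z).
Proof.
move=> z1; elim: n => [|n IHn].
  by rewrite expr0 subrr ComplexField.Normc.normc0 mul0r.
have -> : 1 - z ^+ n.+1 = (1 - z ^+ n) + z ^+ n * (1 - z).
  by rewrite exprSr; ring.
apply: le_trans (le_normcD _ _) _.
by rewrite ComplexField.Normc.normcM normcX z1 expr1n mul1r -natr1 mulrDl mul1r lerD2r.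
Qed.

(** Instead of a lower bound for the sine near 0, take the multiple m of j / Q
that lands between a quarter and a half turn: there the distance to 1 is at
least 1, and multiplying the angle by m multiplies the distance at most by m. *)
Lemma normc_one_sub_e_ge Q j : (0 < j)%N -> (2 * j <= Q)%N ->
  j%:R / Q%:R <= normc (1 - e_ (j%:R / Q%:R : R)) / 2.
Proof.
move=> j0 jQ.
(* the largest m with m * j / Q <= 1 / 2; it is more than half of Q / (2 j),
   which puts m * j / Q above 1 / 4 *)
pose m := (Q %/ (2 * j))%N.
have Q0 : 0 < Q%:R :> R by rewrite ltr0n; lia.
have m0 : (0 < m)%N by rewrite divn_gt0 ?muln_gt0.
have mQ : (m * (2 * j) <= Q)%N by exact: leq_divM.
have Qm : (Q < m.+1 * (2 * j))%N by apply: ltn_ceil; rewrite muln_gt0.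
have mjQ : (2 * (m * j) <= Q)%N by lia.
have Qmj : (Q <= 4 * (m * j))%N.
  have : (j <= m * j)%N by rewrite leq_pmull.
  lia.
have mj : 1 / 4 <= (j%:R / Q%:R * m%:R : R) <= 1 / 2.
  rewrite mulrAC -natrM mulnC ler_pdivlMr// ler_pdivrMr//.
  move: mjQ Qmj; rewrite -!(ler_nat R) !natrM; lra.
have := normc_one_sub_e_ge1 mj; rewrite e_Mn.
move=> /le_trans/(_ (normc_one_sub_expr _ (normc_e_ _))).
have m0R : 0 < m%:R :> R by rewrite ltr0n.
case/andP: mj => _; set u := j%:R / _; set v := normc _ => um mv.
by rewrite -(ler_pM2r m0R); lra.
Qed.

Lemma normc_one_sub_e_sub Q j : (0 < j < Q)%N ->
  normc (1 - e_ ((Q - j)%:R / Q%:R : R)) = normc (1 - e_ (j%:R / Q%:R : R)).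
Proof.
move=> /andP[j0 jQ].
rewrite natrB 1?ltnW// mulrBl mulfV ?pnatr_eq0; last by lia.
set t := _ / _.
have -> : 1 - e_ (1 - t) = - e_ (- t) * (1 - e_ t).
  by rewrite e_D e_1 mul1r mulrBr mulr1 mulNr mulrC e_N; ring.
rewrite ComplexField.Normc.normcM normcN.
by rewrite normc_e_ mul1r.
Qed.

Lemma normc_one_sub_e_gt0 Q j : (0 < j < Q)%N ->
  0 < normc (1 - e_ (j%:R / Q%:R : R)).
Proof.
have half i : (0 < i)%N -> (2 * i <= Q)%N -> 0 < normc (1 - e_ (i%:R / Q%:R : R)).
  move=> i0 iQ; have := normc_one_sub_e_ge i0 iQ.
  have : 0 < i%:R / Q%:R :> R by rewrite divr_gt0 ?ltr0n//; lia.
  lra.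
move=> jQ; case: (leqP (2 * j) Q) => h; first by apply: half => //; case/andP: jQ.
by rewrite -normc_one_sub_e_sub//; apply: half; lia.
Qed.

(** One of the two terms on the right bounds the left-hand side, according to
whether j / Q is nearer to 0 or to 1; adding them avoids a minimum and doubles
the final sums only. *)
Lemma inv_normc_one_sub_e_le Q j : (0 < j < Q)%N ->
  2 / normc (1 - e_ (j%:R / Q%:R : R)) <= Q%:R / j%:R + Q%:R / (Q - j)%:R.
Proof.
move=> jQ.
have half i : (0 < i)%N -> (2 * i <= Q)%N ->
    2 / normc (1 - e_ (i%:R / Q%:R)) <= Q%:R / i%:R :> R.
  move=> i0 iQ; have := normc_one_sub_e_ge i0 iQ; set v := normc _.
  have Q0 : 0 < Q%:R :> R by rewrite ltr0n; lia.
  have i0R : 0 < i%:R :> R by rewrite ltr0n.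
  move=> h; rewrite -[leLHS]invf_div -[leRHS]invf_div lef_pV2 ?posrE ?divr_gt0//.
  have : 0 < v / 2 by apply: lt_le_trans h; rewrite divr_gt0.
  by rewrite pmulr_lgt0 ?invr_gt0.
have ge0 (i k : nat) : 0 <= i%:R / k%:R :> R by rewrite divr_ge0.
case: (leqP (2 * j) Q) => h.
  by apply: le_trans (half _ _ h) _; rewrite ?lerDl//; case/andP: jQ.
rewrite -normc_one_sub_e_sub//; apply: le_trans (half _ _ _) _; [lia|lia|].
by rewrite lerDr.
Qed.

(** The sum telescopes after multiplication by 1 - z. *)
Lemma geometric_sum_normc z u v : normc z = 1 ->
  normc (\sum_(u <= l < v) z ^+ l) * normc (1 - z) <= 2.
Proof.
move=> z1; case: (leqP v u) => [vu|uv].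
  by rewrite big_geq// ComplexField.Normc.normc0 mul0r.
rewrite mulrC -ComplexField.Normc.normcM mulr_sumr.
have -> : \sum_(u <= l < v) (1 - z) * z ^+ l = z ^+ u - z ^+ v.
  transitivity (- \sum_(u <= l < v) (z ^+ l.+1 - z ^+ l)).
    by rewrite -sumrN; apply: eq_bigr => i _; rewrite exprS; ring.
  by rewrite telescope_sumr 1?ltnW// opprB.
by apply: le_trans (le_normcB _ _) _; rewrite !normcX z1 !expr1n.
Qed.

(** * Linear phases and their sums over residues *)

(** An upper bound for a geometric sum with ratio e (j / Q) and at most M terms:
the trivial one when the ratio is 1, and otherwise the one given by
inv_normc_one_sub_e_le, which no longer depends on the length. *)
Definition spike (Q : nat) (M : R) (j : nat) : R :=
  if (j %% Q)%N == 0%N then M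
  else Q%:R / (j %% Q)%:R + Q%:R / (Q - j %% Q)%:R.

Lemma spike_ge0 Q M j : 0 <= M -> 0 <= spike Q M j.
Proof. by move=> M0; rewrite /spike; case: ifP => // _; rewrite addr_ge0 ?divr_ge0. Qed.

Lemma spike_mod Q M j : spike Q M (j %% Q) = spike Q M j.
Proof. by rewrite /spike modn_mod. Qed.

Lemma linear_phase_sum Q (M : R) j u v : (0 < Q)%N -> (v - u)%:R <= M ->
  normc (\sum_(u <= l < v) e_ ((j * l)%:R / Q%:R)) <= spike Q M j.
Proof.
move=> Q0 uvM.
have -> : \sum_(u <= l < v) e_ ((j * l)%:R / Q%:R : R) =
          \sum_(u <= l < v) e_ ((j %% Q)%:R / Q%:R) ^+ l.
  apply: eq_bigr => l _.
  by rewrite -e_Mn mulrAC -natrM -(e_modn _ Q0) -modnMml e_modn.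
rewrite /spike; case: ifPn => [/eqP->|j0].
  apply: le_trans (le_normc_sum _ _ _) _.
  under eq_bigr do rewrite normcX normc_e_ expr1n.
  by rewrite big_const_nat iter_addr_0; apply: le_trans uvM.
have := geometric_sum_normc u v (normc_e_ ((j %% Q)%:R / Q%:R : R)).
have jQ : (0 < j %% Q < Q)%N by rewrite lt0n j0 ltn_pmod.
rewrite -ler_pdivlMr ?normc_one_sub_e_gt0// => /le_trans; apply.
exact: inv_normc_one_sub_e_le.
Qed.

Lemma ln_ge_one_sub_inv (t : R) : 0 < t -> 1 - t^-1 <= ln t.
Proof.
move=> t0; rewrite -lerN2 -lnV ?posrE// opprB.
have -> : t^-1 = 1 + (t^-1 - 1) by ring.
apply: le_trans (le_ln1Dx _) _; last by lra.
by rewrite ltrBrDl subrr invr_gt0.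
Qed.

(** Each new term 1 / (n + 1) is at most the increment ln ((n + 1) / n). *)
Lemma harmonic_le n : (0 < n)%N -> \sum_(1 <= j < n.+1) (j%:R : R)^-1 <= 1 + ln n%:R.
Proof.
elim: n => // -[|n] IHn _; first by rewrite big_nat1 invr1 ln1 addr0.
rewrite big_nat_recr//=; apply: le_trans (lerD (IHn isT) (lexx _)) _.
have := @ln_ge_one_sub_inv (n.+2%:R / n.+1%:R) _; rewrite divr_gt0// => /(_ isT).
rewrite invf_div ln_div ?posrE// => h.
have : (n.+2%:R : R)^-1 = 1 - n.+1%:R / n.+2%:R.
  by rewrite -[X in X - _](@mulfV _ n.+2%:R) ?pnatr_eq0// -mulrBl -natrB// subSnn mul1r.
by move=> ->; rewrite -addrA lerD2l -lerBrDl.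
Qed.

Lemma sum_periodic (F : nat -> R) Q u : (forall j, F (j + Q)%N = F j) ->
  \sum_(u <= r < u + Q) F r = \sum_(0 <= r < Q) F r.
Proof.
move=> perF; elim: u => [|u <-]; first by rewrite add0n.
case: Q perF => [|Q] perF; first by rewrite !addn0 !big_geq.
have uQ : (u < u + Q.+1)%N by rewrite addnS ltnS leq_addr.
by rewrite addSn big_nat_recr//= perF [RHS]big_ltn// addrC.
Qed.

(** As c is invertible modulo Q, the map r |-> b + c r permutes the residues. *)
Lemma sum_linear_mod (F : nat -> R) Q b c : (0 < Q)%N -> coprime Q c ->
  \sum_(0 <= r < Q) F ((b + c * r) %% Q)%N = \sum_(0 <= j < Q) F j.
Proof.
move=> Q0 Qc; rewrite !big_mkord.
pose h (r : 'I_Q) := Ordinal (ltn_pmod (b + c * r) Q0).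
rewrite [RHS](reindex_inj (h := h)) //.
move=> r s /(congr1 val) /= /eqP; rewrite eqn_modDl => /eqP rs; apply: val_inj => /=.
have ltr := ltn_ord r; have lts := ltn_ord s.
wlog le_rs : r s rs ltr lts / (r <= s)%N.
  by move=> H; case: (leqP r s) => [|/ltnW] ?; [|symmetry]; apply: H.
have : (Q %| c * s - c * r)%N by rewrite -eqn_mod_dvd ?leq_mul2l ?le_rs ?orbT// rs.
rewrite -mulnBr Gauss_dvdr// => /dvdnP[k]; case: k => [|k]; first by lia.
by nia.
Qed.

Lemma sum_spike Q M : (0 < Q)%N ->
  \sum_(0 <= j < Q) spike Q M j <= M + 2 * Q%:R * (1 + ln Q%:R).
Proof.
move=> Q0; rewrite big_ltn// {1}/spike mod0n eqxx lerD2l.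
have -> : \sum_(1 <= j < Q) spike Q M j =
    \sum_(1 <= j < Q) (Q%:R / j%:R + Q%:R / (Q - j)%:R).
  by apply: eq_big_nat => j /andP[j0 jQ]; rewrite /spike modn_small// eqn0Ngt j0.
rewrite big_split /= [X in _ + X]big_nat_rev /=.
have -> : \sum_(1 <= i < Q) Q%:R / (Q - (1 + Q - i.+1))%:R =
          \sum_(1 <= i < Q) Q%:R / i%:R :> R.
  by apply: eq_big_nat => j /andP[j0 jQ]; congr (_ / _%:R); lia.
rewrite -mulr_sumr; set S := \sum_(_ <= _ < _) _.
have SQ : S <= 1 + ln Q%:R.
  apply: le_trans (harmonic_le Q0).
  by rewrite [leRHS]big_nat_recr//= lerDl invr_ge0.
have : 0 < Q%:R :> R by rewrite ltr0n.
nra.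
Qed.

(** The progression b + c r meets each residue once in each block of length Q;
a sum over T consecutive r is covered by at most T / Q + 1 such blocks. *)
Lemma sum_spike_linear Q M b c u T : (0 < Q)%N -> 0 <= M -> coprime Q c ->
  \sum_(u <= r < u + T) spike Q M (b + c * r)
    <= (T%:R / Q%:R + 1) * (M + 2 * Q%:R * (1 + ln Q%:R)).
Proof.
move=> Q0 M0 Qc; set B := M + _.
have blocks k v : \sum_(v <= r < v + k * Q) spike Q M (b + c * r) <= k%:R * B.
  elim: k v => [|k IHk] v; first by rewrite mul0n addn0 big_geq// mul0r.
  rewrite mulSn addnA (big_cat_nat (n := v + Q)) ?leq_addr//=.
  rewrite -nat1r mulrDl mul1r lerD//.
  rewrite (sum_periodic (F := fun r => spike Q M (b + c * r))).
    apply: le_trans (sum_spike M Q0).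
    rewrite -(sum_linear_mod (spike Q M) b Q0 Qc); apply: ler_sum => i _.
    by rewrite spike_mod.
  move=> j; rewrite -spike_mod -[in RHS]spike_mod; congr spike.
  by rewrite mulnDr addnA addnC modnMDl.
have TQ : (T <= (T %/ Q).+1 * Q)%N by apply: ltnW; apply: ltn_ceil.
apply: le_trans (_ : _ <= \sum_(u <= r < u + (T %/ Q).+1 * Q) spike Q M (b + c * r)) _.
  rewrite [leRHS](big_cat_nat (n := u + T)) ?leq_addr ?leq_add2l//=.
  by rewrite lerDl sumr_ge0// => i _; apply: spike_ge0.
apply: le_trans (blocks _ _) _; apply: ler_wpM2r.
  by apply: le_trans (sum_spike M Q0); apply: sumr_ge0 => i _; apply: spike_ge0.
rewrite -natr1 lerD2r ler_pdivlMr ?ltr0n// -natrM ler_nat.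
exact: leq_divM.
Qed.
End Phases.

(** * Divisor sums *)
Section DivisorSums.

Lemma sum_divisors (V : nmodType) (F : nat -> V) n Y : (0 < n <= Y)%N ->
  \sum_(1 <= d < Y.+1 | (d %| n)%N) F d = \sum_(d <- divisors n) F d.
Proof.
move=> /andP[n0 nY]; rewrite -big_filter; apply: perm_big; apply: uniq_perm.
- by rewrite filter_uniq ?iota_uniq.
- exact: divisors_uniq.
move=> d; rewrite mem_filter mem_index_iota -dvdn_divisors//.
case dn: (d %| n)%N => //=; rewrite (dvdn_gt0 n0 dn) ltnS /=.
exact: leq_trans (dvdn_leq n0 dn) nY.
Qed.

(** Induction on Y: the quotient Y / d grows exactly when d divides the new Y. *)
Lemma sum_multiples (V : nmodType) (F : nat -> V) d Y : (0 < d)%N ->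
  \sum_(1 <= e < (Y %/ d).+1) F e = \sum_(1 <= n < Y.+1 | (d %| n)%N) F (n %/ d)%N.
Proof.
move=> d0; elim: Y => [|Y IHY]; first by rewrite div0n !big_geq.
rewrite [RHS]big_mkcond big_nat_recr//= -big_mkcond/= -IHY divnS//.
by case: (d %| Y.+1)%N => /=; rewrite ?add0n ?addr0// add1n big_nat_recr.
Qed.

(** Both sides run over the pairs (d, e) with d * e <= Y, on the right grouped by
the product n = d * e.  All Dirichlet convolutions below are handled through this
regrouping. *)
Lemma sum_hyperbola (V : nmodType) (F : nat -> nat -> V) Y :
  \sum_(1 <= d < Y.+1) \sum_(1 <= e < (Y %/ d).+1) F d e =
  \sum_(1 <= n < Y.+1) \sum_(d <- divisors n) F d (n %/ d)%N.
Proof.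
transitivity (\sum_(1 <= d < Y.+1) \sum_(1 <= n < Y.+1 | (d %| n)%N) F d (n %/ d)%N).
  by apply: eq_big_nat => d /andP[d0 _]; apply: sum_multiples.
rewrite (exchange_big_dep xpredT)//=; apply: eq_big_nat => n nY.
by rewrite sum_divisors.
Qed.

Lemma sum_hyperbola_swap (V : nmodType) (F : nat -> nat -> V) Y :
  \sum_(1 <= d < Y.+1) \sum_(1 <= e < (Y %/ d).+1) F d e =
  \sum_(1 <= e < Y.+1) \sum_(1 <= d < (Y %/ e).+1) F d e.
Proof.
have widen (G : nat -> nat -> V) : 
    \sum_(1 <= d < Y.+1) \sum_(1 <= e < (Y %/ d).+1) G d e =
    \sum_(1 <= d < Y.+1) \sum_(1 <= e < Y.+1 | (d * e <= Y)%N) G d e.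
  apply: eq_big_nat => d /andP[d0 _].
  rewrite (big_nat_widen _ _ Y.+1) ?ltnS ?leq_div//.
  by apply: eq_bigl => e; rewrite ltnS leq_divRL// mulnC.
rewrite !widen (exchange_big_dep xpredT)//=; apply: eq_bigr => e _.
by apply: eq_bigl => d; rewrite mulnC.
Qed.
End DivisorSums.

(** * The Moebius and von Mangoldt functions *)
Section ArithmeticFunctions.
Variable R : realType.

(** A product over the primes dividing n rather than a power of -1, so that the
effect of one more prime factor can be read off factor by factor. *)
Definition moebius (n : nat) : R :=
  \prod_(p <- primes n) (if logn p n == 1%N then -1 else 0).

Definition mangoldt (n : nat) : R :=
  if primes n is [:: p] then ln p%:R else 0.

Lemma moebius_norm_le1 n : `|moebius n| <= 1.
Proof.
rewrite /moebius normr_prod.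
suff /andP[] : 0 <= \prod_(p <- primes n)
    `|if logn p n == 1%N then -1 else 0 : R| <= 1 by [].
elim/big_rec: _ => [|p a _ /andP[a0 a1]]; first by rewrite ler01 lexx.
rewrite mulr_ge0//= mulr_ile1//.
by case: ifP => _; rewrite ?normrN1 ?normr0.
Qed.

Lemma moebius1 : moebius 1 = 1.
Proof. by rewrite /moebius big_nil. Qed.

Lemma moebius_prime_mul p d : prime p -> (0 < d)%N ->
  moebius (p * d) = if (p %| d)%N then 0 else - moebius d.
Proof.
move=> p_pr d0; have p0 := prime_gt0 p_pr.
have pd0 : (0 < p * d)%N by rewrite muln_gt0 p0.
have lpp : logn p p = 1%N by rewrite logn_prime// eqxx.
case: ifPn => pd.
  rewrite /moebius (bigD1_seq p) ?primes_uniq//=; last first.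
    by rewrite mem_primes p_pr pd0 dvdn_mulr.
  rewrite lognM// lpp.
  by have := pfactor_dvdn 1 p_pr d0; rewrite expn1 pd => /esym; case: (logn p d) => // k _; rewrite mul0r.
have primes_pd : perm_eq (primes (p * d)) (p :: primes d).
  apply: uniq_perm; rewrite ?primes_uniq//= ?primes_uniq ?andbT.
    by rewrite mem_primes p_pr d0.
  move=> r; rewrite inE primesM// primes_prime// inE//.
rewrite /moebius (perm_big _ primes_pd)/= big_cons.
have lp : logn p d = 0%N by rewrite logn_coprime ?prime_coprime.
rewrite lognM// lpp lp/= mulN1r; congr (- _).
apply: eq_big_seq => r rd; rewrite lognM//.
suff -> : logn r p = 0%N by [].
rewrite logn_coprime// prime_coprime ?dvdn_prime2//.
  by apply: contraNneq pd => rp; move: rd; rewrite mem_primes -rp => /and3P[].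
  by move: rd; rewrite mem_primes => /and3P[].
by move: rd; rewrite mem_primes => /and3P[].
Qed.

(** Let p be a prime factor of n > 1.  The divisors of n prime to p are those of
n / p prime to p, and multiplying them by p gives the divisors that are multiples
of p but not of p ^ 2, with the opposite sign; multiples of p ^ 2 contribute 0. *)
Lemma sum_moebius_divisors n : (0 < n)%N ->
  \sum_(d <- divisors n) moebius d = (n == 1%N)%:R.
Proof.
move=> n0; case: (eqVneq n 1%N) => [->|n1]; first by rewrite big_seq1 moebius1.
have n_gt1 : (1 < n)%N by lia.
set p := pdiv n; have p_pr : prime p by exact: pdiv_prime.
have p0 := prime_gt0 p_pr.
have /dvdnP[n' nE] : (p %| n)%N by exact: pdiv_dvd.
rewrite mulnC in nE; have n'0 : (0 < n')%N by move: n0; rewrite nE muln_gt0 => /andP[].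
rewrite (bigID (fun d => (p %| d)%N))/=.
have -> : \sum_(d <- divisors n | (p %| d)%N) moebius d =
          \sum_(d <- divisors n') moebius (p * d).
  rewrite -big_filter -(big_map (muln p) xpredT moebius); apply: perm_big.
  apply: uniq_perm; rewrite ?filter_uniq ?divisors_uniq//.
    by rewrite map_inj_uniq ?divisors_uniq// => a b /eqP; rewrite eqn_pmul2l// => /eqP.
  move=> d; rewrite mem_filter -dvdn_divisors//; apply/andP/mapP.
    case=> /dvdnP[e ->]; rewrite mulnC nE dvdn_pmul2l// => en.
    by exists e; rewrite // -dvdn_divisors.
  case=> e; rewrite -dvdn_divisors// => en ->; rewrite dvdn_mulr//.
  by rewrite nE dvdn_pmul2l.
have -> : \sum_(d <- divisors n | ~~ (p %| d)%N) moebius d =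
          \sum_(d <- divisors n' | ~~ (p %| d)%N) moebius d.
  rewrite -big_filter -[RHS]big_filter; apply: perm_big.
  apply: uniq_perm; rewrite ?filter_uniq ?divisors_uniq// => d.
  rewrite !mem_filter -!dvdn_divisors//; case pd: (p %| d)%N => //=.
  by rewrite nE Gauss_dvdr// coprime_sym prime_coprime// pd.
rewrite [X in X + _]big_seq_cond [X in X + _](eq_bigr (fun d => if (p %| d)%N then 0 else - moebius d)).
  rewrite -big_seq_cond (bigID (fun d => (p %| d)%N))/= big1 ?add0r.
    by rewrite -big_split big1//= => d /negPf->; rewrite addNr.
  by move=> d ->.
by move=> d; rewrite andbT -dvdn_divisors// => dn; rewrite moebius_prime_mul// (dvdn_gt0 n'0).
Qed.

Lemma mangoldt_ge0 n : 0 <= mangoldt n.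
Proof.
rewrite /mangoldt; case: (primes n) (mem_primes ^~ n) => // p [|//] h.
have := h p; rewrite inE eqxx => /esym/and3P[p_pr _ _].
by rewrite ln_ge0// ler1n prime_gt0.
Qed.

Lemma mangoldt_prime p : prime p -> mangoldt p = ln p%:R.
Proof. by move=> p_pr; rewrite /mangoldt primes_prime. Qed.

Lemma mangoldt_neq0 n : mangoldt n != 0 ->
  [/\ prime (pdiv n), (0 < logn (pdiv n) n)%N & n = (pdiv n ^ logn (pdiv n) n)%N].
Proof.
rewrite /mangoldt; case E: (primes n) => [|p [|//]]; rewrite ?eqxx// => _.
have : p \in primes n by rewrite E inE.
rewrite mem_primes => /and3P[p_pr n0 pn].
have n1 : (1 < n)%N by apply: leq_trans (prime_gt1 p_pr) (dvdn_leq n0 pn).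
have pE : pdiv n = p.
  have : pdiv n \in primes n by rewrite mem_primes pdiv_prime// n0 pdiv_dvd.
  by rewrite E inE => /eqP.
rewrite pE; split => //; first by rewrite logn_gt0 E inE.
by rewrite {1}(prod_prime_decomp n0) prime_decompE E /= big_seq1.
Qed.

Lemma mangoldt_pfactor p k : prime p -> mangoldt (p ^ k.+1) = ln p%:R.
Proof. by move=> p_pr; rewrite /mangoldt primesX// primes_prime. Qed.

(** Induction on n: with n = p n' and p prime, the divisors of n that do not divide
n' contain exactly one prime power, the exact power of p dividing n, and it
contributes ln p. *)
Lemma sum_mangoldt_divisors n : (0 < n)%N ->
  \sum_(d <- divisors n) mangoldt d = ln n%:R.
Proof.
elim/ltn_ind: n => n IHn n0.
case: (eqVneq n 1%N) => [->|n1]; first by rewrite big_seq1 ln1.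
have n_gt1 : (1 < n)%N by lia.
set p := pdiv n; have p_pr : prime p by exact: pdiv_prime.
have p0 := prime_gt0 p_pr; have p1 := prime_gt1 p_pr.
have /dvdnP[n' nE] : (p %| n)%N by exact: pdiv_dvd.
rewrite mulnC in nE; have n'0 : (0 < n')%N by move: n0; rewrite nE muln_gt0 => /andP[].
have n'n : (n' < n)%N by rewrite nE; nia.
rewrite (bigID (fun d => (d %| n')%N))/=.
have -> : \sum_(d <- divisors n | (d %| n')%N) mangoldt d =
          \sum_(d <- divisors n') mangoldt d.
  rewrite -big_filter; apply: perm_big.
  apply: uniq_perm; rewrite ?filter_uniq ?divisors_uniq// => d.
  rewrite mem_filter -!dvdn_divisors//; case dn: (d %| n')%N => //=.
  by rewrite nE dvdn_mull.
rewrite IHn//; set v := logn p n'.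
have pv : \sum_(d <- divisors n | ~~ (d %| n')%N) mangoldt d = ln p%:R.
  rewrite big_mkcond (bigD1_seq (p ^ v.+1)%N) ?divisors_uniq//=; last first.
    by rewrite -dvdn_divisors// nE expnS dvdn_pmul2l// pfactor_dvdn.
  rewrite pfactor_dvdn// ltnn/= mangoldt_pfactor// big_seq_cond big1 ?addr0//.
  move=> d /andP[]; rewrite -dvdn_divisors// => dn dpv; case: ifP => // dn'.
  apply: contraNeq dn' => /mangoldt_neq0[r_pr j0 dE].
  set r := pdiv d in r_pr j0 dE *; set j := logn r d in j0 dE.
  case: (eqVneq r p) => [rp|rp].
    rewrite dE rp pfactor_dvdn//.
    have : (j <= v.+1)%N.
      have : (p ^ j %| p * n')%N by rewrite -nE -{1}rp -dE.
      by rewrite pfactor_dvdn ?muln_gt0 ?p0// lognM// logn_prime// eqxx add1n.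
    rewrite leq_eqVlt => /orP[/eqP jv|//].
    by move: dpv; rewrite dE rp jv eqxx.
  move: dn; rewrite nE Gauss_dvdr// dE coprimeXl//.
  by rewrite prime_coprime// dvdn_prime2.
rewrite pv nE natrM lnM ?posrE ?ltr0n// addrC//.
Qed.

Lemma mangoldt_le n : (0 < n)%N -> mangoldt n <= ln n%:R.
Proof.
move=> n0; rewrite -sum_mangoldt_divisors// (bigD1_seq n) ?divisors_id ?divisors_uniq//=.
by rewrite lerDl sumr_ge0// => d _; apply: mangoldt_ge0.
Qed.

Lemma sum_mangoldt_divisors_cond (P : pred nat) n : (0 < n)%N ->
  \sum_(d <- divisors n | P d) mangoldt d <= ln n%:R.
Proof.
move=> n0; rewrite -sum_mangoldt_divisors// big_mkcond/=; apply: ler_sum => d _.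
by case: ifP => // _; apply: mangoldt_ge0.
Qed.

(** The proper prime powers up to Y have a base p <= s, and the powers of p up to Y
are divisors of the largest of them, so that together they contribute at most
ln Y for each p. *)
Lemma sum_mangoldt_nonprime Y s : (0 < Y)%N -> (Y < s.+1 ^ 2)%N ->
  \sum_(1 <= n < Y.+1 | ~~ prime n) mangoldt n <= s%:R * ln Y%:R.
Proof.
move=> Y0 Ys.
pose top p := (p ^ trunc_log p Y)%N.
have topY p : prime p -> (0 < top p <= Y)%N.
  by move=> p_pr; rewrite expn_gt0 prime_gt0//= trunc_logP ?prime_gt1.
apply: le_trans (_ : _ <= \sum_(1 <= p < s.+1 | prime p)
   \sum_(1 <= n < Y.+1 | (n %| top p)%N) mangoldt n) _; last first.
  apply: le_trans (_ : _ <= \sum_(1 <= p < s.+1 | prime p) ln Y%:R) _.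
    apply: ler_sum => p p_pr; have /andP[t0 tY] := topY _ p_pr.
    rewrite sum_divisors ?topY// sum_mangoldt_divisors//.
    by rewrite ler_ln ?posrE ?ltr0n// ler_nat.
  rewrite big_mkcond /=.
  apply: le_trans (_ : _ <= \sum_(1 <= p < s.+1) ln Y%:R) _.
    by apply: ler_sum => p _; case: ifP => // _; rewrite ln_ge0// ler1n.
  by rewrite big_const_nat iter_addr_0 subSS subn0 mulr_natl.
rewrite (exchange_big_dep xpredT)//= big_mkcond/=.
apply: ler_sum_nat => n /andP[n0 nY].
have ge0 (Q : pred nat) : 0 <= \sum_(1 <= i < s.+1 | Q i) mangoldt n.
  by apply: sumr_ge0 => i _; apply: mangoldt_ge0.
case: ifP => // npr.
case: (eqVneq (mangoldt n) 0) => [->|/mangoldt_neq0[]].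
  by rewrite sumr_ge0.
set p := pdiv n; set k := logn p n => p_pr k0 nE.
have p1 := prime_gt1 p_pr.
have k1 : (1 < k)%N.
  rewrite ltn_neqAle k0 andbT eq_sym; apply: contraNneq npr => k1.
  by rewrite nE k1 expn1.
have ps : (p <= s)%N.
  rewrite -ltnS -(ltn_exp2r _ _ (isT : 0 < 2)%N); apply: leq_ltn_trans Ys.
  by apply: leq_trans (_ : n <= Y)%N; rewrite // nE leq_exp2l.
rewrite big_mkcond/= (bigD1_seq p) ?iota_uniq//=; last first.
  by rewrite mem_index_iota ltnS ps prime_gt0.
rewrite p_pr /= {2}nE dvdn_exp2l.
  by rewrite lerDl sumr_ge0// => i _; case: ifP => // _; apply: mangoldt_ge0.
by apply: trunc_log_max; rewrite // -nE.
Qed.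
End ArithmeticFunctions.

(** * Vaughan's identity *)
Section Vaughan.
Variables (R : realType) (V : lmodType R).
Local Notation moebius := (@moebius R).
Local Notation mangoldt := (@mangoldt R).

(** The convolution identity g = moebius * (1 * g), summed against f: insert
the sum of moebius over the divisors of t, which detects t = 1, and collect the
remaining two factors into one variable l. *)
Lemma moebius_inversion_sum (g : nat -> R) (f : nat -> V) Y :
  \sum_(1 <= m < Y.+1) g m *: f m =
  \sum_(1 <= d < Y.+1) moebius d *:
    \sum_(1 <= l < (Y %/ d).+1) (\sum_(m <- divisors l) g m) *: f (d * l)%N.
Proof.
transitivity (\sum_(1 <= m < Y.+1) \sum_(1 <= d < (Y %/ m).+1)
    \sum_(1 <= e < (Y %/ (m * d)).+1) (moebius d * g m) *: f (m * d * e)%N).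
  apply: eq_big_nat => m /andP[m0 mY].
  rewrite (eq_bigr (fun d => \sum_(1 <= e < (Y %/ m %/ d).+1)
     (moebius d * g m) *: f (m * (d * e))%N)); last first.
    by move=> d _; rewrite divnMA; apply: eq_bigr => e _; rewrite mulnA.
  rewrite (sum_hyperbola (fun d e => (moebius d * g m) *: f (m * (d * e))%N)).
  rewrite big_ltn ?ltnS ?divn_gt0//= big_seq1 moebius1 mul1r divn1 mul1n muln1.
  rewrite big_nat big1 ?addr0// => t /andP[t1 _].
  have t0 : (0 < t)%N by lia.
  rewrite (eq_big_seq (fun d => (moebius d * g m) *: f (m * t)%N)); last first.
    by move=> d; rewrite -dvdn_divisors// => dt; rewrite (mulnC d) divnK.
  rewrite -scaler_suml -mulr_suml sum_moebius_divisors//.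
  by rewrite gtn_eqF// mul0r scale0r.
rewrite sum_hyperbola_swap; apply: eq_big_nat => d /andP[d0 dY].
transitivity (moebius d *: \sum_(1 <= m < (Y %/ d).+1)
    \sum_(1 <= e < (Y %/ d %/ m).+1) g m *: f (d * (m * e))%N).
  rewrite scaler_sumr; apply: eq_bigr => m _.
  rewrite scaler_sumr -divnMA mulnC; apply: eq_bigr => e _.
  by rewrite scalerA mulnA [(d * m)%N]mulnC.
congr (_ *: _); rewrite (sum_hyperbola (fun m e => g m *: f (d * (m * e))%N)).
apply: eq_big_nat => l /andP[l0 _]; rewrite scaler_suml.
by apply: eq_big_seq => m; rewrite -dvdn_divisors// => ml; rewrite (mulnC m) divnK.
Qed.

(** Apply moebius_inversion_sum to mangoldt cut off below P.  For d >= P the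
inner coefficient is supported on l >= P, so both variables are long (type II).
For d < P write the inner coefficient as the full divisor sum, which is ln l,
minus its part over m < P; in both of the resulting sums the last variable is
free of arithmetic weight (type I).  Leaving the sum over m inside the coefficient
of l matters: this coefficient is then at most ln l, whereas truncated sums of
moebius would have to be bounded by the divisor function, losing further
logarithms. *)
Lemma vaughan_identity (f : nat -> V) P Y :
  \sum_(1 <= n < Y.+1) mangoldt n *: f n =
  \sum_(1 <= n < Y.+1 | (n < P)%N) mangoldt n *: f n
  + (\sum_(1 <= d < Y.+1 | (d < P)%N) moebius d *:
      \sum_(1 <= l < (Y %/ d).+1) ln l%:R *: f (d * l)%N
  - \sum_(1 <= d < Y.+1 | (d < P)%N) moebius d *:
      \sum_(1 <= m < (Y %/ d).+1 | (m < P)%N) mangoldt m *: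
        \sum_(1 <= e < (Y %/ d %/ m).+1) f (d * m * e)%N)
  + \sum_(1 <= d < Y.+1 | (P <= d)%N) moebius d *:
      \sum_(1 <= l < (Y %/ d).+1)
        (\sum_(m <- divisors l | (P <= m)%N) mangoldt m) *: f (d * l)%N.
Proof.
pose g m := if (P <= m)%N then mangoldt m else 0.
have gE l : \sum_(m <- divisors l) g m = \sum_(m <- divisors l | (P <= m)%N) mangoldt m.
  by rewrite [RHS]big_mkcond.
rewrite [LHS](bigID (fun n => (n < P)%N))/= -addrA; congr (_ + _).
transitivity (\sum_(1 <= m < Y.+1) g m *: f m).
  rewrite big_mkcond; apply: eq_bigr => n _; rewrite -leqNgt /g.
  by case: ifP => _; rewrite ?scale0r.
rewrite moebius_inversion_sum (bigID (fun n => (n < P)%N))/=; congr (_ + _); last first.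
  apply: eq_big => [d|d _]; first by rewrite -leqNgt.
  by congr (_ *: _); apply: eq_bigr => l _; rewrite gE.
rewrite -sumrB; apply: eq_bigr => d _; rewrite -scalerBr; congr (_ *: _).
have -> : \sum_(1 <= m < (Y %/ d).+1 | (m < P)%N) mangoldt m *:
        \sum_(1 <= e < (Y %/ d %/ m).+1) f (d * m * e)%N =
     \sum_(1 <= l < (Y %/ d).+1)
        (\sum_(m <- divisors l | (m < P)%N) mangoldt m) *: f (d * l)%N.
  pose h m := if (m < P)%N then mangoldt m else 0.
  transitivity (\sum_(1 <= m < (Y %/ d).+1)
        \sum_(1 <= e < (Y %/ d %/ m).+1) h m *: f (d * (m * e))%N).
    rewrite big_mkcond; apply: eq_bigr => m _; rewrite -scaler_sumr /h.
    case: ifP => _; rewrite ?scale0r//; congr (_ *: _).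
    by apply: eq_bigr => e _; rewrite mulnA.
  rewrite (sum_hyperbola (fun m e => h m *: f (d * (m * e))%N)).
  apply: eq_big_nat => l /andP[l0 _].
  rewrite [X in _ = X *: _]big_mkcond scaler_suml.
  by apply: eq_big_seq => m; rewrite -dvdn_divisors// => ml; rewrite (mulnC m) divnK.
rewrite -sumrB; apply: eq_big_nat => l /andP[l0 _]; rewrite -scalerBl; congr (_ *: _).
rewrite gE -(@sum_mangoldt_divisors R)// [in RHS](bigID (fun m => (m < P)%N))/=.
by rewrite [X in _ = X - _]addrC addrK; apply: eq_bigl => m; rewrite leqNgt.
Qed.
End Vaughan.

(** * Inequalities for weighted sums *)
Section Estimates.
Variable R : realType.
Local Notation V := (Rcomplex R).
Local Notation normc := ComplexField.Normc.normc.

Lemma rcomplex_normZ (r : R) (z : V) : `|r *: z| = `|r| * `|z|.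
Proof.
case: z => a b.
change (Num.sqrt ((r * a) ^+ 2 + (r * b) ^+ 2) = `|r| * Num.sqrt (a ^+ 2 + b ^+ 2)).
by rewrite !exprMn -mulrDr sqrtrM ?sqr_ge0// sqrtr_sqr.
Qed.

(** Abel transformation: the differences w i - w (i + 1) and the last weight w n
are nonnegative and add up to w u. *)
Lemma abel_norm_le (w : nat -> R) (g : nat -> V) (B : R) u n :
  (forall i, (u <= i)%N -> w i.+1 <= w i) -> (forall i, (u <= i)%N -> 0 <= w i) ->
  (forall m, (m <= n)%N -> `|\sum_(u <= l < m) g l| <= B) ->
  `|\sum_(u <= l < n) w l *: g l| <= w u * B.
Proof.
move=> w_decr w_ge0 gB.
have B0 : 0 <= B by apply: le_trans (gB 0%N _); rewrite ?normr_ge0.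
case: (leqP n u) => [nu|/ltnW un].
  by rewrite big_geq// normr0 mulr_ge0// w_ge0.
have -> : \sum_(u <= l < n) w l *: g l =
    \sum_(u <= l < n) (w l - w l.+1) *: (\sum_(u <= k < l.+1) g k)
    + w n *: \sum_(u <= k < n) g k.
  elim: n un gB => [|n IHn] un gB.
    by rewrite leqn0 in un; rewrite !big_geq// scaler0 addr0.
  move: un; rewrite leq_eqVlt => /orP[/eqP<-|un].
    by rewrite !big_geq// scaler0 addr0.
  rewrite 2?big_nat_recr//= IHn//; last by move=> m mn; apply: gB; apply: leqW.
  rewrite [in X in _ = _ + X]big_nat_recr//= scalerDr.
  rewrite [in X in _ = _ + X + _]big_nat_recr//=.
  rewrite -!addrA; congr (_ + _); rewrite scalerBl scalerDr.
  by rewrite -!scalerDr subrK.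
apply: le_trans (ler_normD _ _) _.
apply: le_trans (_ : _ <= \sum_(u <= l < n) (w l - w l.+1) * B + w n * B) _.
  apply: lerD; last by rewrite rcomplex_normZ ger0_norm ?w_ge0// ler_wpM2l ?w_ge0// gB.
  apply: le_trans (ler_norm_sum _ _ _) _; apply: ler_sum_nat => l /andP[ul ln].
  rewrite rcomplex_normZ ger0_norm ?subr_ge0 ?w_decr// ler_wpM2l ?subr_ge0 ?w_decr//.
  exact: gB.
rewrite -mulr_suml -mulrDl.
have -> : \sum_(u <= l < n) (w l - w l.+1) = w u - w n.
  rewrite -opprB -telescope_sumr// -sumrN.
  by apply: eq_bigr => l _; rewrite opprB.
by rewrite subrK.
Qed.

Lemma sqr_sum_le (I : Type) (r : seq I) (F : I -> R) :
  (\sum_(i <- r) F i) ^+ 2 <= (size r)%:R * \sum_(i <- r) F i ^+ 2.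
Proof.
have H : \sum_(i <- r) \sum_(j <- r) (F i ^+ 2 + F j ^+ 2) =
    2 * ((size r)%:R * \sum_(i <- r) F i ^+ 2).
  under eq_bigr do rewrite big_split/=.
  rewrite big_split/= [X in _ + X]exchange_big/= -mulr2n -[LHS]mulr_natl; congr (_ * _).
  rewrite mulr_sumr; apply: eq_bigr => i _.
  by rewrite big_const_seq count_predT iter_addr_0 mulr_natl.
suff : \sum_(i <- r) \sum_(j <- r) (2 * F i * F j) <=
       \sum_(i <- r) \sum_(j <- r) (F i ^+ 2 + F j ^+ 2).
  have -> : \sum_(i <- r) \sum_(j <- r) (2 * F i * F j) = 2 * (\sum_(i <- r) F i) ^+ 2.
    rewrite expr2 mulrA [X in X * _]mulr_sumr mulr_suml; apply: eq_bigr => i _.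
    by rewrite mulr_sumr.
  by rewrite H ler_pM2l.
apply: ler_sum => i _; apply: ler_sum => j _.
by have := sqr_ge0 (F i - F j); rewrite sqrrB; lra.
Qed.

(** Re (w * conj v) is the scalar product of the plane; keeping the real part makes
the expansion of the square an identity between reals. *)
Lemma normc_sum_sqr (I : Type) (r : seq I) (c : I -> R) (w : I -> V) :
  `|\sum_(i <- r) c i *: w i| ^+ 2 =
  \sum_(i <- r) \sum_(j <- r) c i * c j * complex.Re (w i * conjc (w j)).
Proof.
have sqr (z : V) : `|z| ^+ 2 = complex.Re z ^+ 2 + complex.Im z ^+ 2.
  by case: z => x y; rewrite [`|_|]/(Num.sqrt _) sqr_sqrtr ?addr_ge0 ?sqr_ge0.
rewrite sqr (raddf_sum (@complex.Re R : V -> R)) (raddf_sum (@complex.Im R : V -> R)).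
rewrite !expr2 !mulr_suml -big_split/=; apply: eq_bigr => i _.
rewrite !mulr_sumr -big_split/=; apply: eq_bigr => j _.
case: (w i) (w j) => [x y] [x' y'] /=; ring.
Qed.

Lemma norm_Re_le (z : R[i]) : `|complex.Re z| <= normc z.
Proof.
case: z => x y /=; rewrite -sqrtr_sqr ler_sqrt ?addr_ge0 ?sqr_ge0//.
by rewrite lerDl sqr_ge0.
Qed.

(** * Type I and type II sums with a rational phase *)

Definition phase (Q a n : nat) : V := e_ ((a * n)%:R / Q%:R).

Section RationalPhase.
Variables Q a : nat.
Hypotheses (Q_gt0 : (0 < Q)%N) (Qa : coprime Q a).
Local Notation f := (phase Q a).
Local Notation G := (2 * Q%:R * (1 + ln Q%:R) : R).

Lemma sum_spike_bound_ge0 : 0 <= G.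
Proof.
by rewrite !mulr_ge0// addr_ge0// ln_ge0// ler1n.
Qed.

Lemma norm_phase n : `|f n| = 1.
Proof. exact: normc_e_. Qed.

Lemma phase_sum_le (M : R) d u v : (v - u)%:R <= M ->
  `|\sum_(u <= l < v) f (d * l)| <= spike Q M (a * d).
Proof.
move=> uvM; have := @linear_phase_sum R Q M (a * d) u v Q_gt0 uvM.
apply: le_trans; rewrite le_eqVlt; apply/orP; left; apply/eqP.
by congr normc; apply: eq_bigr => l _; rewrite /phase mulnA.
Qed.

(** Partial summation needs nonincreasing weights, so ln l is written as
ln N - (ln N - ln l); this costs the factor 2. *)
Lemma phase_sum_ln_le n N d : (n <= N)%N -> (0 < N)%N ->
  `|\sum_(1 <= l < n.+1) ln l%:R *: f (d * l)| <= 2 * ln N%:R * spike Q n%:R (a * d).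
Proof.
move=> nN N0.
have sub1 (m k : nat) : (m <= k.+1)%N -> (m - 1)%:R <= k%:R :> R.
  by rewrite ler_nat; lia.
pose w l := ln N%:R - ln (minn l N)%:R : R.
have -> : \sum_(1 <= l < n.+1) ln l%:R *: f (d * l) =
   ln N%:R *: \sum_(1 <= l < n.+1) f (d * l) - \sum_(1 <= l < n.+1) w l *: f (d * l).
  rewrite scaler_sumr -sumrB; apply: eq_big_nat => l /andP[l1 ln].
  by rewrite -scalerBl /w (minn_idPl _) ?subKr//; lia.
have lnN : 0 <= ln N%:R :> R by rewrite ln_ge0// ler1n.
apply: le_trans (ler_normB _ _) _; rewrite -mulrA mulr_natl mulr2n; apply: lerD.
  by rewrite rcomplex_normZ ger0_norm// ler_wpM2l// phase_sum_le// sub1.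
apply: le_trans (abel_norm_le (B := spike Q n%:R (a * d)) _ _ _) _.
- move=> i i1; rewrite /w lerD2l lerN2 ler_ln ?posrE ?ltr0n ?ler_nat; lia.
- move=> i i1; rewrite /w subr_ge0 ler_ln ?posrE ?ltr0n ?ler_nat; lia.
- by move=> m mn; apply: phase_sum_le; apply: sub1.
by rewrite /w (minn_idPl _)// ln1 subr0.
Qed.

Lemma dvdn_coprime_mul d : (Q %| a * d)%N = (Q %| d)%N.
Proof. exact: Gauss_dvdr. Qed.

Lemma spikeE M j : spike Q M j = (if (Q %| j)%N then M else 0) + spike Q (0 : R) j.
Proof. by rewrite /spike /dvdn; case: ifP => _; rewrite ?addr0 ?add0r. Qed.

(** The d strictly between 0 and Q are not divisible by Q, so that the trivial bound for
a geometric sum never occurs and the sum is at most a full block. *)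
Lemma sum_spike_below (M : nat -> R) P : (P <= Q)%N ->
  \sum_(1 <= d < P) spike Q (M d) (a * d) <= G.
Proof.
move=> PQ; apply: le_trans (_ : _ <= \sum_(0 <= d < Q) spike Q 0 ((0 + a * d) %% Q)) _; last first.
  rewrite (sum_linear_mod (spike Q (0 : R)) 0 Q_gt0 Qa).
  by apply: le_trans (sum_spike 0 Q_gt0) _; rewrite add0r.
have ge0 i : 0 <= spike Q (0 : R) i by apply: spike_ge0.
rewrite [leRHS]big_ltn// -[leLHS]add0r; apply: lerD => //.
apply: le_trans (_ : _ <= \sum_(1 <= d < P) spike Q 0 ((0 + a * d) %% Q)) _.
  apply: ler_sum_nat => d /andP[d0 dP]; rewrite spike_mod spikeE dvdn_coprime_mul.
  by rewrite gtnNdvd ?add0r// (leq_trans dP).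
case: (leqP P 1) => [P1|P1]; first by rewrite [leLHS]big_geq//; apply: sumr_ge0.
rewrite [leRHS](big_cat_nat (n := P))/= ?(ltnW P1)//.
by rewrite lerDl sumr_ge0.
Qed.

(** The trivial bound Y / n has to be used for n = Q e, which leaves a harmonic sum
over e. *)
Lemma sum_resonant (Y : R) D : 0 <= Y -> (0 < D)%N ->
  \sum_(1 <= n < D.+1 | (Q %| n)%N) Y / n%:R <= Y / Q%:R * (1 + ln D%:R).
Proof.
move=> Y0 D0.
have -> : \sum_(1 <= n < D.+1 | (Q %| n)%N) Y / n%:R =
    \sum_(1 <= e < (D %/ Q).+1) Y / Q%:R * e%:R^-1.
  rewrite sum_multiples//; apply: eq_bigr => n /dvdnP[k ->].
  by rewrite mulnK// natrM invfM mulrA mulrAC.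
rewrite -mulr_sumr; apply: ler_wpM2l; first by rewrite divr_ge0.
case: (posnP (D %/ Q)) => [->|DQ].
  by rewrite big_geq// addr_ge0// ln_ge0// ler1n.
apply: le_trans (harmonic_le _ DQ) _.
by rewrite lerD2l ler_ln ?posrE ?ltr0n// ler_nat leq_div.
Qed.

Lemma sum_spike_level Y D : (0 < D)%N ->
  \sum_(1 <= n < D.+1) spike Q (Y %/ n)%:R (a * n) <=
    Y%:R / Q%:R * (1 + ln D%:R) + (D%:R / Q%:R + 1) * G.
Proof.
move=> D0; apply: le_trans (_ : _ <=
   \sum_(1 <= n < D.+1 | (Q %| n)%N) Y%:R / n%:R +
   \sum_(1 <= n < D.+1) spike Q 0 (0 + a * n)) _.
  rewrite [X in _ <= X + _]big_mkcond -big_split/=.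
  apply: ler_sum_nat => n /andP[n0 _].
  rewrite spikeE dvdn_coprime_mul add0n lerD2r; case: ifP => // _.
  by rewrite ler_pdivlMr ?ltr0n// -natrM ler_nat leq_divM.
apply: lerD; first exact: sum_resonant.
have := @sum_spike_linear R Q 0 0 a 1 D Q_gt0 (lexx _) Qa.
by rewrite add0r add1n.
Qed.

Lemma sum_below_le (F : nat -> R) P Y : (forall d, 0 <= F d) ->
  \sum_(1 <= d < Y.+1 | (d < P)%N) F d <= \sum_(1 <= d < P) F d.
Proof.
move=> F0; case: (leqP P Y.+1) => [PY|YP]; first by rewrite [leRHS](big_nat_widen _ _ _ _ _ PY).
apply: le_trans (_ : _ <= \sum_(1 <= d < Y.+1) F d) _.
  by rewrite big_mkcond/=; apply: ler_sum => d _; case: ifP.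
by rewrite [leRHS](big_cat_nat (n := Y.+1)) ?(ltnW YP)//= lerDl sumr_ge0.
Qed.

Lemma typeI_ln_le (mu : nat -> R) P Y : (forall d, `|mu d| <= 1) ->
  (0 < Y)%N -> (P <= Q)%N ->
  `|\sum_(1 <= d < Y.+1 | (d < P)%N) mu d *:
      \sum_(1 <= l < (Y %/ d).+1) ln l%:R *: f (d * l)| <= 2 * ln Y%:R * G.
Proof.
move=> mu1 Y0 PQ.
have lnY : 0 <= ln Y%:R :> R by rewrite ln_ge0// ler1n.
apply: le_trans (ler_norm_sum _ _ _) _.
apply: le_trans (_ : _ <= \sum_(1 <= d < Y.+1 | (d < P)%N)
    2 * ln Y%:R * spike Q (Y %/ d)%:R (a * d)) _.
  apply: ler_sum => d _; rewrite rcomplex_normZ -[leRHS]mul1r ler_pM//.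
  by apply: phase_sum_ln_le => //; apply: leq_div.
rewrite -mulr_sumr ler_wpM2l ?mulr_ge0//.
apply: le_trans (sum_spike_below (fun d => (Y %/ d)%:R) PQ).
by apply: sum_below_le => d; apply: spike_ge0.
Qed.

(** The two outer variables enter the inner sum only through their product n, and
the coefficients of a given n add up to at most ln n. *)
Lemma typeI_mangoldt_le (mu : nat -> R) P Y : (forall d, `|mu d| <= 1) ->
  (0 < Y)%N -> (0 < P)%N ->
  `|\sum_(1 <= d < Y.+1 | (d < P)%N) mu d *:
      \sum_(1 <= m < (Y %/ d).+1 | (m < P)%N) mangoldt R m *:
        \sum_(1 <= e < (Y %/ d %/ m).+1) f (d * m * e)|
  <= ln Y%:R * (Y%:R / Q%:R * (1 + ln (P ^ 2)%:R) + ((P ^ 2)%:R / Q%:R + 1) * G).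
Proof.
move=> mu1 Y0 P0.
have lnY : 0 <= ln Y%:R :> R by rewrite ln_ge0// ler1n.
pose S n : R := spike Q (Y %/ n)%:R (a * n).
have S0 n : 0 <= S n by apply: spike_ge0.
pose H m d : R := if (d < P)%N && (m < P)%N then mangoldt R m * S (m * d)%N else 0.
apply: le_trans (ler_norm_sum _ _ _) _.
apply: le_trans (_ : _ <= \sum_(1 <= d < Y.+1) \sum_(1 <= m < (Y %/ d).+1) H m d) _.
  rewrite big_mkcond/=; apply: ler_sum => d _; rewrite /H.
  case: ifP => dP /=; last by rewrite sumr_ge0.
  rewrite rcomplex_normZ -[leRHS]mul1r ler_pM//.
  apply: le_trans (ler_norm_sum _ _ _) _; rewrite big_mkcond/=.
  apply: ler_sum => m _; case: ifP => // mP.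
  rewrite rcomplex_normZ ger0_norm ?mangoldt_ge0// ler_wpM2l ?mangoldt_ge0//.
  rewrite -divnMA mulnC; apply: phase_sum_le; rewrite subSS subn0.
  by rewrite mulnC.
rewrite sum_hyperbola_swap sum_hyperbola.
apply: le_trans (_ : _ <= \sum_(1 <= n < Y.+1 | (n < (P ^ 2).+1)%N) ln Y%:R * S n) _; last first.
  rewrite -mulr_sumr ler_wpM2l//; apply: le_trans (sum_below_le _ _ S0) _.
  by apply: sum_spike_level; rewrite expn_gt0 P0.
rewrite [leRHS]big_mkcond/=; apply: ler_sum_nat => n /andP[n0 nY].
have HE m : m \in divisors n -> H m (n %/ m)%N =
    if (n %/ m < P)%N && (m < P)%N then mangoldt R m * S n else 0.
  by rewrite -dvdn_divisors// /H => mn; rewrite (mulnC m) divnK.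
rewrite (eq_big_seq _ HE).
case: ifP => [_|nP].
  apply: le_trans (_ : _ <= \sum_(m <- divisors n) mangoldt R m * S n) _.
    by apply: ler_sum => m _; case: ifP => // _; rewrite mulr_ge0 ?mangoldt_ge0.
  rewrite -mulr_suml sum_mangoldt_divisors// ler_wpM2r//.
  by rewrite ler_ln ?posrE ?ltr0n// ler_nat.
rewrite big_seq big1// => m; rewrite -dvdn_divisors// => mn.
case: ifP => // /andP[h1 h2]; exfalso; move/negP: nP; apply.
rewrite ltnS -(divnK mn) -mulnn; apply: leq_mul; exact: ltnW.
Qed.

(** Conjugation is multiplication of the argument by Q - 1, which keeps all
arguments natural numbers. *)
Lemma conj_phase n : conjc (f n) = f (Q.-1 * n).
Proof.
have QQ : e_ (Q%:R * (a * n)%:R / Q%:R) = 1 :> R[i].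
  by rewrite mulrC mulKf ?pnatr_eq0 -?lt0n// e_nat.
rewrite /phase conj_e_ -[LHS]mul1r -[X in X * _]QQ -e_D; congr e_.
rewrite -mulrBl; congr (_ / _).
by rewrite -natrM -natrB ?leq_pmull// [in RHS]mulnCA -subn1 mulnBl mul1n.
Qed.

Lemma phase_prod_sum_le l l' u v (M : R) : (v - u)%:R <= M ->
  normc (\sum_(u <= d < v) f (d * l) * conjc (f (d * l'))) <=
   spike Q M (a * l + a * Q.-1 * l').
Proof.
move=> uvM.
have -> : \sum_(u <= d < v) f (d * l) * conjc (f (d * l')) =
   \sum_(u <= d < v) e_ (((a * l + a * Q.-1 * l') * d)%:R / Q%:R : R).
  apply: eq_bigr => k _; rewrite conj_phase /phase -e_D -mulrDl -natrD.
  by congr (e_ (_%:R / _)); lia.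
exact: linear_phase_sum.
Qed.
(** Open the square and sum over d first: the condition d l, d l' <= Y restricts
d to an interval, so for fixed l, l' a geometric sum with frequency l - l'
remains, and its bound is averaged over l'.  Having d on the outside lets the
hyperbolic condition stay in place. *)
Lemma typeII_block_square_le (b : nat -> R) (B : R) Y M : (0 < M)%N -> 0 <= B ->
  (forall l, (0 < l <= Y)%N -> `|b l| <= B) ->
  \sum_(M <= d < 2 * M) `|\sum_(1 <= l < (Y %/ d).+1) b l *: f (d * l)| ^+ 2
   <= (Y %/ M)%:R * (B ^+ 2 * (((Y %/ M)%:R / Q%:R + 1) * (M%:R + G))).
Proof.
move=> M0 B0 bB; set N := (Y %/ M)%N.
pose c d l := if (d * l <= Y)%N then b l else 0.
pose rho d l l' := complex.Re (f (d * l) * conjc (f (d * l'))).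
have -> : \sum_(M <= d < 2 * M) `|\sum_(1 <= l < (Y %/ d).+1) b l *: f (d * l)| ^+ 2 =
  \sum_(M <= d < 2 * M) \sum_(1 <= l < N.+1) \sum_(1 <= l' < N.+1)
      c d l * c d l' * rho d l l'.
  apply: eq_big_nat => d /andP[Md _]; have d0 := leq_trans M0 Md.
  rewrite -normc_sum_sqr; congr (_ ^+ 2); congr `|_|.
  rewrite (big_nat_widen _ _ N.+1) ?ltnS ?leq_div2l// big_mkcond/=.
  apply: eq_bigr => l _; rewrite ltnS leq_divRL// mulnC /c.
  by case: ifP => _; rewrite ?scale0r.
rewrite exchange_big/=.
apply: le_trans (_ : _ <= \sum_(1 <= l < N.+1) B ^+ 2 *
    (((N%:R / Q%:R + 1) * (M%:R + G)))) _; last first.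
  by rewrite big_const_nat iter_addr_0 subSS subn0 [leRHS]mulr_natl.
apply: ler_sum_nat => l /andP[l0 lN]; rewrite exchange_big/=.
apply: le_trans (_ : _ <= \sum_(1 <= l' < 1 + N) B ^+ 2 *
    spike Q M%:R (a * l + a * Q.-1 * l')) _; last first.
  rewrite -mulr_sumr; apply: ler_wpM2l; first exact: sqr_ge0.
  apply: sum_spike_linear => //.
  by rewrite coprimeMr Qa coprimenP.
rewrite add1n; apply: ler_sum_nat => l' /andP[l'0 l'N].
have NY : (N <= Y)%N by exact: leq_div.
have bl : `|b l| <= B by apply: bB; rewrite l0 (leq_trans _ NY).
have bl' : `|b l'| <= B by apply: bB; rewrite l'0 (leq_trans _ NY).
(* the values of d allowed by both conditions are those in [M, K) *)
pose K := minn (2 * M) (minn (Y %/ l).+1 (Y %/ l').+1).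
have -> : \sum_(M <= d < 2 * M) c d l * c d l' * rho d l l' =
   b l * b l' * complex.Re (\sum_(M <= d < K) f (d * l)%N * conjc (f (d * l')%N)).
  rewrite (raddf_sum (@complex.Re R : V -> R)) mulr_sumr.
  rewrite (big_nat_widen _ K (2 * M)) ?geq_minl// [RHS]big_mkcond/=.
  apply: eq_big_nat => d /andP[Md dM].
  rewrite /K !leq_min dM/= !ltnS !leq_divRL// /c.
  by do 2 case: ifP => _; rewrite ?mul0r ?mulr0 ?mul0r.
apply: le_trans (ler_norm _) _; rewrite normrM normrM expr2.
apply: ler_pM => //; first by rewrite mulr_ge0.
  exact: ler_pM.
apply: le_trans (norm_Re_le _) _.
by apply: phase_prod_sum_le; rewrite ler_nat leq_subLR addnn -mul2n geq_minl.
Qed.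

(** Cauchy-Schwarz removes mu; a block has M terms and l runs up to Y / M, and the
product of these two lengths is at most Y. *)
Lemma typeII_block_le (mu b : nat -> R) (B : R) Y M :
  (0 < M)%N -> 0 <= B -> (forall d, `|mu d| <= 1) ->
  (forall l, (0 < l <= Y)%N -> `|b l| <= B) ->
  (\sum_(M <= d < 2 * M) `|mu d *: \sum_(1 <= l < (Y %/ d).+1) b l *: f (d * l)|) ^+ 2
   <= Y%:R * (B ^+ 2 * (((Y %/ M)%:R / Q%:R + 1) * (M%:R + G))).
Proof.
move=> M0 B0 mu1 bB.
apply: le_trans (_ : _ <= (\sum_(M <= d < 2 * M)
    `|\sum_(1 <= l < (Y %/ d).+1) b l *: f (d * l)|) ^+ 2) _.
  rewrite ler_sqr ?nnegrE ?sumr_ge0//.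
  apply: ler_sum => d _; rewrite rcomplex_normZ -[leRHS]mul1r.
  by apply: ler_wpM2r.
apply: le_trans (sqr_sum_le _ _) _.
rewrite size_iota mul2n -addnn addnK addnn -mul2n.
apply: le_trans (ler_wpM2l (ler0n _ _) (typeII_block_square_le M0 B0 bB)) _.
set Z := B ^+ 2 * _; rewrite mulrA -natrM; apply: ler_wpM2r; last first.
  by rewrite ler_nat mulnC leq_divM.
have := sum_spike_bound_ge0.
by move=> G0; apply: mulr_ge0; [exact: sqr_ge0|apply: mulr_ge0; apply: addr_ge0; rewrite ?divr_ge0].
Qed.
End RationalPhase.
End Estimates.

(** * The sum over primes *)
Section Assembly.
Variable R : realType.
Local Notation V := (Rcomplex R).

Lemma ln2_ge_half : 1 / 2 <= ln 2 :> R.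
Proof.
have := @ln_ge_one_sub_inv R 2 (ltr0n _ 2); lra.
Qed.

Lemma trunc_log2_le_ln Y : (0 < Y)%N -> (trunc_log 2 Y)%:R <= 2 * ln Y%:R :> R.
Proof.
move=> Y0; have := ln2_ge_half; set k := trunc_log 2 Y.
have : ln (2 ^ k)%:R <= ln Y%:R :> R.
  by rewrite ler_ln ?posrE ?ltr0n ?expn_gt0// ler_nat trunc_logP.
rewrite natrX lnXn// -mulr_natl; have : 0 <= k%:R :> R by [].
nra.
Qed.

(** Here u = x / P: expanding the product gives N M / Q, M, N and Q up to factors
of order L, and each of these four is at most u. *)
Lemma typeII_saving_le (x u X L Y Q N M G : R) :
  1 <= L -> 0 < u -> 0 <= Y -> Y <= x -> 0 < Q -> 0 < M -> 0 <= N -> N * M <= x ->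
  x / Q <= u -> Q <= u -> M <= u -> N <= u -> 0 <= G -> G <= 4 * (Q * L) ->
  x * u = X ^+ 2 ->
  Y * (L ^+ 2 * ((N / Q + 1) * (M + G))) <= (4 * (L ^+ 2 * X)) ^+ 2.
Proof.
move=> L1 u0 Y0 Yx Q0 M0 N0 NM xQ Qu Mu Nu G0 GL XX.
have NQ : 0 <= N / Q + 1 by rewrite addr_ge0 ?divr_ge0// ltW.
have step : (N / Q + 1) * (M + G) <= 16 * (L ^+ 2 * u).
  apply: le_trans (_ : _ <= (N / Q + 1) * (M + 4 * (Q * L))) _.
    by rewrite ler_wpM2l ?lerD2l.
  have -> : (N / Q + 1) * (M + 4 * (Q * L)) = N * M / Q + 4 * (N * L) + M + 4 * (Q * L).
    by field; rewrite gt_eqF.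
  have h1 : N * M / Q <= u by apply: le_trans xQ; rewrite ler_pM2r ?invr_gt0.
  have h2 : N * L <= u * L by rewrite ler_pM2r//; lra.
  have h3 : Q * L <= u * L by rewrite ler_pM2r//; lra.
  have h4 : u <= u * L by rewrite ler_peMr// ltW.
  have h5 : u * L <= L ^+ 2 * u.
    by rewrite expr2 [leRHS]mulrC mulrA ler_peMr// mulr_ge0 ?ltW//; lra.
  lra.
have x0 : 0 <= x by lra.
apply: le_trans (_ : _ <= x * (L ^+ 2 * (16 * (L ^+ 2 * u)))) _.
  apply: ler_pM => //; last by rewrite ler_wpM2l ?sqr_ge0.
  by rewrite mulr_ge0 ?sqr_ge0// mulr_ge0// addr_ge0// ltW.
have -> : x * (L ^+ 2 * (16 * (L ^+ 2 * u))) = 16 * L ^+ 4 * (x * u) by ring.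
by rewrite XX le_eqVlt; apply/orP; left; apply/eqP; ring.
Qed.

Section RationalPhaseBounds.
Variables Q a : nat.
Hypotheses (Q_gt0 : (0 < Q)%N) (Qa : coprime Q a).
Local Notation f := (phase R Q a).
Local Notation G := (2 * Q%:R * (1 + ln Q%:R) : R).

(** Dyadic blocks [M, 2 M) with M = 2^i P.  When M * P > Y the inner sum has only
l < P and vanishes; the number of blocks is at most 2 ln Y + 1 because ln 2 is
at least 1 / 2. *)
Lemma typeII_sum_le (mu b : nat -> R) (B W : R) P Y :
  (0 < P)%N -> (0 < Y)%N -> 0 <= B -> 0 <= W -> (forall d, `|mu d| <= 1) ->
  (forall l, (0 < l <= Y)%N -> `|b l| <= B) ->
  (forall l, (0 < l < P)%N -> b l = 0) ->
  (forall M, (P <= M)%N -> (M * P <= Y)%N ->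
    Y%:R * (B ^+ 2 * (((Y %/ M)%:R / Q%:R + 1) * (M%:R + G))) <= W ^+ 2) ->
  `|\sum_(1 <= d < Y.+1 | (P <= d)%N) mu d *:
      \sum_(1 <= l < (Y %/ d).+1) b l *: f (d * l)| <= (2 * ln Y%:R + 1) * W.
Proof.
move=> P0 Y0 B0 W0 mu1 bB bP HW; apply: le_trans (ler_norm_sum _ _ _) _.
pose t d := `|mu d *: \sum_(1 <= l < (Y %/ d).+1) b l *: f (d * l)|.
change (\sum_(1 <= d < Y.+1 | (P <= d)%N) t d <= (2 * ln Y%:R + 1) * W).
have t0 d : 0 <= t d by apply: normr_ge0.
have block i : \sum_(2 ^ i * P <= d < 2 ^ i.+1 * P) t d <= W.
  set M := (2 ^ i * P)%N.
  have M0 : (0 < M)%N by rewrite muln_gt0 expn_gt0.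
  have PM : (P <= M)%N by rewrite leq_pmull// expn_gt0.
  rewrite expnS -mulnA -/M; case: (leqP (M * P) Y) => [MPY|YMP].
    rewrite -ler_sqr ?nnegrE ?sumr_ge0//.
    by apply: le_trans (HW _ PM MPY); apply: typeII_block_le.
  rewrite big_nat big1// => d /andP[Md _].
  rewrite /t big_nat big1 ?scaler0 ?normr0// => l /andP[l0 ld].
  rewrite bP ?scale0r// l0 /=; apply: leq_trans ld _.
  rewrite ltn_divLR ?(leq_trans M0)//; apply: leq_trans YMP _.
  by rewrite mulnC leq_mul2l Md orbT.
have blocks i : \sum_(P <= d < 2 ^ i * P) t d <= i%:R * W.
  elim: i => [|i IHi]; first by rewrite mul1n big_geq// mul0r.
  rewrite (big_cat_nat (n := 2 ^ i * P))/= ?leq_pmull ?expn_gt0//; last first.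
    by rewrite leq_mul2r leq_exp2l// leqnSn orbT.
  by rewrite -natr1 mulrDl mul1r lerD.
pose I := (trunc_log 2 Y).+1.
have YI : (Y.+1 <= 2 ^ I * P)%N.
  by apply: leq_trans (leq_pmulr _ P0); apply: trunc_log_ltn.
apply: le_trans (_ : _ <= \sum_(P <= d < 2 ^ I * P) t d) _; last first.
  apply: le_trans (blocks _) _; apply: ler_wpM2r => //.
  by rewrite /I -natr1 lerD2r trunc_log2_le_ln.
rewrite [leRHS](big_nat_widenl _ 1)//=.
rewrite [leRHS](big_cat_nat (n := Y.+1))//= lerDl.
by apply: sumr_ge0.
Qed.

(** In the application P = q ^ K, so that s = q ^ (K / 2) and X = x / s is the
bound aimed at up to logarithms. *)
Section Saving.
Variables (x s : R) (P : nat).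
Let L := ln x.
Let X := x / s.
Hypotheses (L_ge1 : 1 <= L) (x_gt0 : 0 < x) (s_ge1 : 1 <= s) (sP : s ^+ 2 = P%:R)
  (s5x : s ^+ 5 <= x) (PQ : (P <= Q)%N) (PQx : P%:R * Q%:R <= x).

(** The exponent 2 / 5 enters here: s ^+ 5 <= x is equivalent to P ^ 2 <= X, and
P ^ 2 is the level of the type I sums. *)
Lemma parameter_bounds :
  [/\ P%:R <= X, (P ^ 2)%:R <= X, Q%:R <= x / P%:R & x / P%:R <= X].
Proof.
have s0 : 0 < s by exact: lt_le_trans ltr01 s_ge1.
have P0 : 0 < P%:R :> R by rewrite -sP exprn_gt0.
have s_pow (k : nat) : (k <= 5)%N -> s ^+ k <= x.
  by move=> k5; apply: le_trans s5x; apply: ler_weXn2l.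
split.
- by rewrite ler_pdivlMr// -sP -exprSr s_pow.
- by rewrite ler_pdivlMr// natrX -sP -exprM -exprSr s_pow.
- by rewrite ler_pdivlMr// mulrC.
- rewrite ler_pM2l// lef_pV2 ?posrE// -sP expr2.
  by rewrite ler_peMl// ltW.
Qed.

Lemma ln_nat_le_ln n : (0 < n)%N -> n%:R <= x -> 0 <= (ln n%:R : R) <= L.
Proof.
by move=> n0 nx; rewrite ln_ge0 ?ler1n//= ler_ln ?posrE ?ltr0n.
Qed.

(** With 1 <= L the four parts of Vaughan's identity are at most X L (initial
segment), 8 X L ^ 2 and 10 X L ^ 2 (type I) and 12 X L ^ 3 (type II). *)
Lemma mangoldt_phase_sum_le Y : (0 < Y)%N -> Y%:R <= x ->
  `|\sum_(1 <= n < Y.+1) mangoldt R n *: f n| <= 31 * (L ^+ 3 * X).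
Proof.
move=> Y0 Yx.
have L1 := L_ge1; have s1 := s_ge1; have x0 := x_gt0.
have s0 : 0 < s by exact: lt_le_trans ltr01 s_ge1.
have P0 : 0 < P%:R :> R by rewrite -sP exprn_gt0.
have P1 : (0 < P)%N by rewrite -(ltr0n R).
have [PX P2X QxP xPX] := parameter_bounds.
have Xx : X <= x by rewrite ler_pdivrMr// ler_peMr// ltW.
have q0 : 0 < Q%:R :> R by rewrite ltr0n.
have q1 : 1 <= Q%:R :> R by rewrite ler1n.
have PQr : P%:R <= Q%:R :> R by rewrite ler_nat.
have /andP[lnY0 lnYL] := ln_nat_le_ln Y0 Yx.
have /andP[lnQ0 lnQL] : 0 <= (ln Q%:R : R) <= L.
  by apply: ln_nat_le_ln => //; lra.
have /andP[lnP0 lnPL] : 0 <= (ln (P ^ 2)%:R : R) <= L.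
  by apply: ln_nat_le_ln; rewrite ?expn_gt0 ?P1//; lra.
have X0 : 0 < X by rewrite divr_gt0.
have QX : Q%:R <= X by lra.
have xQ : x / Q%:R <= X.
  by apply: le_trans xPX; rewrite ler_pM2l// lef_pV2 ?posrE.
have YQ : Y%:R / Q%:R <= X.
  by apply: le_trans xQ; rewrite ler_pM2r ?invr_gt0.
have XX : x * (x / P%:R) = X ^+ 2.
  by rewrite /X -sP expr_div_n expr2 mulrA.
clearbody L X.
have G0 : 0 <= G by apply: sum_spike_bound_ge0.
have L0 : 0 <= L by lra.
have GL : G <= 4 * (Q%:R * L).
  have -> : 4 * (Q%:R * L) = 2 * Q%:R * (L + L) by ring.
  by rewrite ler_pM2l ?mulr_gt0//; lra.
have QLX : Q%:R * L <= X * L by rewrite ler_pM2r//; lra.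
pose mu := moebius R.
have mu1 d : `|mu d| <= 1 by apply: moebius_norm_le1.
have W0 : 0 <= 4 * (L ^+ 2 * X).
  by apply: mulr_ge0 => //; apply: mulr_ge0; [exact: sqr_ge0|exact: ltW].
rewrite (vaughan_identity f P Y).
apply: le_trans (_ : _ <= X * L + (8 * (X * L ^+ 2) + 10 * (X * L ^+ 2))
   + 12 * (X * L ^+ 3)) _; last first.
  have h1 : X * L <= X * L ^+ 3.
    by rewrite ler_pM2l// -[leLHS]expr1 ler_weXn2l.
  have h2 : X * L ^+ 2 <= X * L ^+ 3.
    by rewrite ler_pM2l// ler_weXn2l.
  lra.
apply: le_trans (ler_normD _ _) (lerD _ _); last first.
  (* the coefficients satisfy 0 <= b l <= ln l <= L, and a block contributes
     at most W = 4 L^2 X *)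
  apply: le_trans (typeII_sum_le (B := L) (W := 4 * (L ^+ 2 * X)) P1 Y0 _ _ mu1 _ _ _) _.
  - lra.
  - exact: W0.
  - move=> l /andP[l0 lY]; rewrite ger0_norm ?sumr_ge0//; last first.
      by move=> m _; apply: mangoldt_ge0.
    apply: le_trans (sum_mangoldt_divisors_cond _ _ l0) _.
    by apply: le_trans lnYL; rewrite ler_ln ?posrE ?ltr0n ?ler_nat// (leq_trans l0).
  - move=> l /andP[l0 lP]; rewrite big_seq_cond big1// => m.
    rewrite -dvdn_divisors// => /andP[ml Pm].
    by have := dvdn_leq l0 ml; rewrite leqNgt (leq_trans lP Pm).
  - move=> M PM MPY.
    set N := (Y %/ M)%:R.
    have M0 : 0 < M%:R :> R by rewrite ltr0n (leq_trans P1).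
    have NM : N * M%:R <= x.
      by apply: le_trans Yx; rewrite -natrM ler_nat leq_divM.
    have MP : M%:R <= x / P%:R.
      by rewrite ler_pdivlMr// -natrM; apply: le_trans Yx; rewrite ler_nat.
    have NP : N <= x / P%:R.
      rewrite ler_pdivlMr//; apply: le_trans NM.
      by rewrite ler_wpM2l ?ler_nat.
    apply: (@typeII_saving_le x (x / P%:R) X L Y%:R Q%:R N M%:R G) => //.
      by rewrite divr_gt0.
    by rewrite ler_pM2l// lef_pV2 ?posrE.
  have -> : 12 * (X * L ^+ 3) = 3 * L * (4 * (L ^+ 2 * X)) by ring.
  apply: ler_wpM2r; last by lra.
  exact: W0.
apply: le_trans (ler_normD _ _) (lerD _ _).
  (* no cancellation is needed for n < P, as P <= X *)
  apply: le_trans (ler_norm_sum _ _ _) _.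
  apply: le_trans (_ : _ <= \sum_(1 <= n < Y.+1 | (n < P)%N) L) _.
    rewrite big_mkcond [leRHS]big_mkcond/=; apply: ler_sum_nat => n /andP[n0 nY].
    case: ifP => // _; rewrite rcomplex_normZ norm_phase mulr1 ger0_norm ?mangoldt_ge0//.
    apply: le_trans (mangoldt_le _ n0) _; apply: le_trans lnYL.
    by rewrite ler_ln ?posrE ?ltr0n ?ler_nat// (leq_trans n0).
  apply: le_trans (sum_below_le _ _ _) _; first by move=> _; lra.
  rewrite big_const_nat iter_addr_0 -[leLHS]mulr_natl; apply: ler_pM => //.
  by apply: le_trans PX; rewrite ler_nat leq_subr.
apply: le_trans (ler_normB _ _) (lerD _ _).
  apply: le_trans (typeI_ln_le Q_gt0 Qa mu1 Y0 PQ) _.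
  apply: le_trans (_ : _ <= 2 * L * (4 * (X * L))) _; last by nra.
  apply: ler_pM => //; [by rewrite mulr_ge0|by lra|by lra].
apply: le_trans (typeI_mangoldt_le Q_gt0 Qa mu1 Y0 P1) _.
have -> : 10 * (X * L ^+ 2) = L * (X * (2 * L) + 2 * (4 * (X * L))) by ring.
apply: ler_pM => //.
  by rewrite addr_ge0// mulr_ge0// ?addr_ge0 ?divr_ge0.
apply: lerD.
  by apply: ler_pM; rewrite ?divr_ge0 ?addr_ge0//; lra.
apply: le_trans (_ : _ <= ((P ^ 2)%:R / Q%:R + 1) * (4 * (Q%:R * L))) _.
  by rewrite ler_wpM2l// addr_ge0 ?divr_ge0.
have -> : ((P ^ 2)%:R / Q%:R + 1) * (4 * (Q%:R * L)) = 4 * (((P ^ 2)%:R + Q%:R) * L).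
  by field; rewrite gt_eqF.
have : ((P ^ 2)%:R + Q%:R) * L <= (X + X) * L by rewrite ler_pM2r; lra.
lra.
Qed.

Lemma sqrt_le_saving : Num.sqrt x <= X.
Proof.
have s0 : 0 < s by exact: lt_le_trans ltr01 s_ge1.
have X0 : 0 <= X by rewrite divr_ge0 ?ltW.
rewrite -[leRHS]ger0_norm// -sqrtr_sqr ler_sqrt ?sqr_ge0//.
rewrite /X expr_div_n ler_pdivlMr ?exprn_gt0// [leRHS]expr2 ler_pM2l//.
by apply: le_trans s5x; apply: ler_weXn2l.
Qed.

Lemma prime_ln_phase_sum_le Y : (0 < Y)%N -> Y%:R <= x ->
  `|\sum_(1 <= n < Y.+1 | prime n) ln n%:R *: f n| <= 32 * (L ^+ 3 * X).
Proof.
move=> Y0 Yx.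
pose r := Num.truncn (Num.sqrt (Y%:R : R)).
have /andP[rY Yr] := truncn_itv (sqrtr_ge0 (Y%:R : R)).
have rX : r%:R <= X.
  apply: le_trans rY _; apply: le_trans sqrt_le_saving.
  by rewrite ler_sqrt// ltW.
have Yr2 : (Y < r.+1 ^ 2)%N.
  rewrite -(ltr_nat R) natrX -[X in X < _]sqr_sqrtr//.
  by rewrite ltr_sqr ?nnegrE ?sqrtr_ge0.
have -> : \sum_(1 <= n < Y.+1 | prime n) ln n%:R *: f n =
    \sum_(1 <= n < Y.+1) mangoldt R n *: f n -
    \sum_(1 <= n < Y.+1 | ~~ prime n) mangoldt R n *: f n.
  rewrite [in RHS](bigID prime)/= addrK; apply: eq_bigr => p p_pr.
  by rewrite mangoldt_prime.
apply: le_trans (ler_normB _ _) _.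
have lnYL : ln Y%:R <= L by case/andP: (ln_nat_le_ln Y0 Yx).
have X0 : 0 <= X by apply: le_trans rX.
apply: le_trans (lerD (mangoldt_phase_sum_le Y0 Yx) (_ : _ <= X * L)) _.
  apply: le_trans (ler_norm_sum _ _ _) _.
  apply: le_trans (_ : _ <= \sum_(1 <= n < Y.+1 | ~~ prime n) mangoldt R n) _.
    apply: ler_sum => n _; rewrite rcomplex_normZ norm_phase mulr1.
    by rewrite ger0_norm ?mangoldt_ge0.
  apply: le_trans (sum_mangoldt_nonprime _ Y0 Yr2) _.
  by apply: ler_pM => //; rewrite ln_ge0// ler1n.
have : X * L <= X * L ^+ 3.
  by rewrite ler_wpM2l// -[leLHS]expr1 ler_weXn2l.
lra.
Qed.

(** Partial summation removes the weight ln p.  The weights 1 / max (ln n, L / 2)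
are monotone and at most 2 / L; they differ from 1 / ln n only for n < sqrt x,
where the trivial bound is sufficient. *)
Lemma prime_phase_sum_le Y : (0 < Y)%N -> Y%:R <= x ->
  `|\sum_(1 <= p < Y.+1 | prime p) f p| <= 65 * (L ^+ 2 * X).
Proof.
move=> Y0 Yx; have L1 := L_ge1; have s1 := s_ge1; have x0 := x_gt0.
have X0 : 0 < X by rewrite divr_gt0//; lra.
have L20 : 0 < L / 2 by rewrite divr_gt0//; lra.
pose m n : R := Num.max (ln n%:R) (L / 2).
have m0 n : 0 < m n by rewrite lt_max L20 orbT.
pose w n := (m n)^-1.
pose g n : V := if prime n then ln n%:R *: f n else 0.
have main : `|\sum_(1 <= n < Y.+1) w n *: g n| <= 64 * (L ^+ 2 * X).
  apply: le_trans (abel_norm_le (B := 32 * (L ^+ 3 * X)) _ _ _) _.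
  - move=> i i1; rewrite lef_pV2 ?posrE// /m ge_max !le_max lexx orbT andbT.
    by rewrite ler_ln ?posrE ?ltr0n ?ler_nat ?leqnSn.
  - by move=> i _; rewrite invr_ge0 ltW.
  - have B0 := le_trans (normr_ge0 _) (prime_ln_phase_sum_le Y0 Yx).
    move=> [|[|k]] kY; [by rewrite big_geq// normr0..|].
    rewrite /g -big_mkcond; apply: prime_ln_phase_sum_le => //.
    by apply: le_trans Yx; rewrite ler_nat.
  rewrite /w /m ln1 (max_idPr _) ?(ltW L20)// invf_div.
  have -> : 2 / L * (32 * (L ^+ 3 * X)) = 64 * (L ^+ 2 * X).
    by field; rewrite gt_eqF; lra.
  by [].
pose r := Num.truncn (Num.sqrt x).
have /andP[rx xr] := truncn_itv (sqrtr_ge0 x).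
have rX : r%:R <= X by apply: le_trans rx sqrt_le_saving.
have -> : \sum_(1 <= p < Y.+1 | prime p) f p =
    \sum_(1 <= n < Y.+1) w n *: g n +
    \sum_(1 <= n < Y.+1 | prime n) (1 - w n * ln n%:R) *: f n.
  rewrite [X in X + _](eq_bigr (fun n => if prime n then (w n * ln n%:R) *: f n else 0)).
    rewrite -big_mkcond -big_split/=; apply: eq_bigr => n _.
    by rewrite -scalerDl addrC subrK scale1r.
  by move=> n _; rewrite /g; case: ifP => _; rewrite ?scaler0// scalerA.
apply: le_trans (ler_normD _ _) _.
apply: le_trans (lerD main (_ : _ <= X)) _; last first.
  have : X <= L ^+ 2 * X by rewrite ler_peMl ?exprn_ege1// ltW.
  lra.
apply: le_trans rX; apply: le_trans (ler_norm_sum _ _ _) _.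
apply: le_trans (_ : _ <= \sum_(1 <= n < Y.+1 | (n < r.+1)%N) 1) _; last first.
  apply: le_trans (sum_below_le _ _ _) _ => //.
  by rewrite big_const_nat iter_addr_0 subSS subn0.
rewrite big_mkcond [leRHS]big_mkcond/=; apply: ler_sum_nat => n /andP[n0 _].
have lnn0 : 0 <= ln n%:R :> R by rewrite ln_ge0// ler1n.
have wn1 : w n * ln n%:R <= 1.
  by rewrite mulrC ler_pdivrMr// mul1r /m le_max lexx.
have wn0 : 0 <= w n * ln n%:R by rewrite mulr_ge0// invr_ge0 ltW.
case: (leqP n r) => [nr|rn].
  rewrite ltnS nr; case: ifP => // _.
  by rewrite rcomplex_normZ norm_phase mulr1 ger0_norm ?subr_ge0// lerBlDr lerDl.
rewrite ltnS leqNgt rn/=; case: ifP => // _.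
have lnL : L / 2 <= ln n%:R.
  rewrite ler_pdivrMr// mulr_natr -lnXn ?ltr0n// ler_ln ?posrE ?exprn_gt0 ?ltr0n//.
  rewrite -[leLHS](sqr_sqrtr (ltW x0)) ler_sqr ?nnegrE ?sqrtr_ge0//.
  by apply: le_trans (ltW xr) _; rewrite ler_nat.
rewrite /w /m (max_idPl _)// mulVf ?subrr ?scale0r ?normr0//.
by rewrite gt_eqF//; lra.
Qed.
End Saving.
End RationalPhaseBounds.

(** Reducing A modulo Q changes A p / Q by an integer. *)
Lemma prime_exp_sumE (x : R) (A : int) (Q : nat) : (0 < Q)%N ->
  prime_exp_sum x (A%:~R / Q%:R) =
  \sum_(1 <= p < (Num.truncn x).+1 | prime p) phase R Q `|(A %% Q)%Z| p :> V.
Proof.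
move=> Q0; rewrite /prime_exp_sum big_ltn_cond//=.
apply: eq_bigr => p _; rewrite /phase.
have Qn0 : Q%:R != 0 :> R by rewrite pnatr_eq0 -lt0n.
have {1}-> : A = ((A %/ Q)%Z * Q + (`|(A %% Q)%Z|%N : int)).
  by rewrite gez0_abs ?modz_ge0 -?divz_eq//; case: Q Q0 {Qn0}.
rewrite intrD intrM !mulrDl -mulrA mulfV// mulr1 -[p%:R]/(p%:Z%:~R) -intrM e_D e_int mul1r.
by rewrite natrM mulrAC.
Qed.
End Assembly.

Theorem lemma8 (R : realType) (q : nat) (hq : (2 <= q)%N)
    (x : R) (hx : 0 < x)
    (K : nat) (hK : K%:R <= 2 / 5 * log_base q x)
    (Q : nat) (hQ : q%:R ^+ K <= Q%:R :> R) (hQx : Q%:R <= x * q%:R ^- K)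
    (A : int) (hAQ : gcdz A Q%:Z = 1) :
  ComplexField.Normc.normc (prime_exp_sum x (A%:~R / Q%:R))
    <= 102 * ln x ^+ 2 * x * q%:R `^ (- (K%:R / 2)).
Proof.
have q0 : 0 < q%:R :> R by rewrite ltr0n; lia.
have P_gt0 : 0 < (q ^ K)%:R :> R by rewrite ltr0n expn_gt0; lia.
pose s : R := Num.sqrt (q ^ K)%:R.
have sP : s ^+ 2 = (q ^ K)%:R by rewrite sqr_sqrtr// ltW.
have s_ge1 : 1 <= s.
  by rewrite -sqrtr1 ler_sqrt ?ler1n ?ltr0n ?expn_gt0 ?ltW//; lia.
have s0 : 0 < s by exact: lt_le_trans ltr01 s_ge1.
have powE : q%:R `^ (- (K%:R / 2)) = s^-1.
  by rewrite powRN powRrM powR_mulrn ?(ltW q0)// powR12_sqrt ?exprn_ge0 ?(ltW q0)// -natrX.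
have PQ : (q ^ K <= Q)%N by rewrite -(ler_nat R) natrX.
have Q0 : (0 < Q)%N by apply: leq_trans PQ; rewrite expn_gt0; lia.
have PQx : (q ^ K)%:R * Q%:R <= x.
  by rewrite mulrC -ler_pdivlMr// natrX.
have lnq0 : 0 < ln q%:R :> R by rewrite ln_gt0// ltr1n.
have s5x : s ^+ 5 <= x.
  rewrite -ler_ln ?posrE ?exprn_gt0// lnXn//.
  have : ln s *+ 2 = K%:R * ln q%:R.
    by rewrite -lnXn// sP natrX lnXn// mulr_natl.
  move: hK; rewrite /log_base mulrA ler_pdivlMr//; lra.
have Qa : coprime Q `|(A %% Q)%Z|.
  move: hAQ; rewrite -gcdz_modl gcdzC /gcdz /coprime => -[->]//.
rewrite powE (prime_exp_sumE _ _ Q0) -mulrA.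
set Y := Num.truncn x.
have [x2|x2] := ltP x 2.
  have Y2 : (Y < 2)%N by rewrite truncn_lt_nat ?ltW.
  rewrite big_nat_cond big1 ?ComplexField.Normc.normc0.
    by apply: mulr_ge0; [rewrite mulr_ge0 ?sqr_ge0|apply: ltW; apply: divr_gt0].
  move=> p /andP[/andP[p1 pY] /prime_gt1 p2].
  by move: (leq_trans p2 pY); rewrite leqNgt Y2.
have Y0 : (0 < Y)%N by rewrite truncn_gt0; lra.
have Yx : Y%:R <= x by rewrite truncn_le ltW.
have X0 : 0 < x / s by rewrite divr_gt0.
(* for ln x < 1 the inequality is trivial, as then s <= 4 *)
have [L1|L1] := leP 1 (ln x).
  apply: le_trans (prime_phase_sum_le Q0 Qa L1 hx s_ge1 sP s5x PQ PQx Y0 Yx) _.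
  have : 0 <= ln x ^+ 2 * (x / s) by rewrite mulr_ge0 ?sqr_ge0// ltW.
  lra.
have L_half : 1 / 2 <= ln x.
  by apply: le_trans (ln2_ge_half R) _; rewrite ler_ln ?posrE.
have s4 : s <= 4.
  apply: le_trans (_ : s <= s ^+ 5) _; first by rewrite -[leLHS]expr1 ler_weXn2l.
  apply: le_trans s5x _; rewrite leNgt; apply/negP => x4.
  have : ln (2 ^+ 2) <= ln x :> R.
    by rewrite ler_ln ?posrE ?exprn_gt0//; lra.
  rewrite lnXn// mulr2n; have := ln2_ge_half R; lra.
apply: le_trans (_ : _ <= x) _.
  apply: le_trans (le_normc_sum _ _ _) _.
  apply: le_trans Yx; rewrite big_mkcond.
  apply: le_trans (_ : _ <= \sum_(1 <= p < Y.+1) 1) _.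
    by apply: ler_sum => p _; case: ifP => // _; rewrite /phase normc_e_.
  by rewrite big_const_nat iter_addr_0 subSS subn0.
have -> : 102 * ln x ^+ 2 * (x / s) = x * (102 * ln x ^+ 2 / s) by ring.
rewrite ler_peMr ?(ltW hx)// ler_pdivlMr// mul1r.
have : (1 / 2) ^+ 2 <= ln x ^+ 2 by rewrite ler_sqr ?nnegrE//; lra.
lra.
Qed.
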